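(* Let $\mathrm{Per}(F_4)$ be the set of periods of the difference equation $x_{n+4}=\max\{x_{n+3},x_{n+2},x_{n+1},0\}-x_n$, $n\ge 1$, with arbitrary real initial conditions. Then $\mathbb{N}\setminus \mathrm{Per}(F_4)$ is bounded and $\max\left(\mathbb{N}\setminus \mathrm{Per}(F_4)\right)=1674$; that is, $1674\notin \mathrm{Per}(F_4)$ and every natural number $n>1674$ belongs to $\mathrm{Per}(F_4)$.
   Context: $\mathbb{N}=\{1,2,3,\dots\}$. A solution is a real sequence $(x_n)_{n\ge 1}$ satisfying the equation for all $n\ge 1$; it is determined by its initial conditions $(x_1,x_2,x_3,x_4)\in\mathbb{R}^4$. A solution is periodic if there is $m\in\mathbb{N}$ with $x_{n+m}=x_n$ for all $n\ge 1$; the smallest such $m$ is called its period. $\mathrm{Per}(F_4)$ is the set of all natural numbers that are the (smallest) period of some periodic solution. *)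

(* Defs.v *)
From Stdlib Require Import Reals.
Open Scope R_scope.

(* Sequences (x_n)_{n >= 1} are functions [nat -> R] whose value at index 0
   is irrelevant: every condition below only concerns indices n >= 1. *)

Definition solution (x : nat -> R) : Prop :=
  forall n : nat, (1 <= n)%nat ->
    x (n + 4)%nat =
      Rmax (x (n + 3)%nat) (Rmax (x (n + 2)%nat) (Rmax (x (n + 1)%nat) 0))
      - x n.

Definition repeats_every (x : nat -> R) (m : nat) : Prop :=
  (1 <= m)%nat /\ forall n : nat, (1 <= n)%nat -> x (n + m)%nat = x n.

Definition has_period (x : nat -> R) (m : nat) : Prop :=
  repeats_every x m /\ forall k : nat, repeats_every x k -> (m <= k)%nat.

Definition Per_F4 (m : nat) : Prop :=
  exists x : nat -> R, solution x /\ has_period x m.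

Definition non_periods (n : nat) : Prop := (1 <= n)%nat /\ ~ Per_F4 n.

Definition bounded_nat_set (A : nat -> Prop) : Prop :=
  exists B : nat, forall n : nat, A n -> (n <= B)%nat.

Definition is_maximum (A : nat -> Prop) (M : nat) : Prop :=
  A M /\ forall n : nat, A n -> (n <= M)%nat.

(* Main.v *)
Require Import Defs.
From Stdlib Require Import Reals Lra Lia Arith ZArith Bool List Sorted Classical.

(** In a periodic solution start at a maximum [M]; the next three terms
    [a, b, c] then lie in [[0, M]]. If [a >= b >= c] the solution has period
    dividing 11. Otherwise, up to a shift by one, two of them are the values
    [A < B] that stay the same after every maximum, and the third one moves:
    with [beta = B - A] and [gamma = M + 2 * beta], the states after the maxima
    are parametrized by a phase in the circle [[0, gamma)], and the next such
    state comes after 11 steps, or after 10 if the phase is below [beta], with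
    the phase decreased by [beta] modulo [gamma]. This rotation by [beta] is
    periodic iff [q * beta = a * gamma] with [q], [a] coprime, and then the
    period is [11 * q - a]; moreover [beta <= M] means [3 * a <= q], the case
    of equality giving only periods at most 32. Conversely every coprime pair
    with [0 < 3 * a < q] occurs.

    So [n > 32] is a period iff some [q] coprime to [n] satisfies
    [n / 11 < q < 3 * n / 32]. For [n = 1674] only [153, ..., 156] lie in this
    window. The window has length [n / 352], so for large [n] Legendre's sieve
    provides [q], and for [1674 < n <= 3717120] a computation does. *)

(** * Integers coprime to [n] between [n / 11] and [3 * n / 32] *)

Definition nat_prime (p : nat) : Prop :=
  (1 < p)%nat /\ forall d, Nat.divide d p -> d = 1%nat \/ d = p.

Lemma nat_prime_divisor (n : nat) :
  (1 < n)%nat -> exists p, nat_prime p /\ Nat.divide p n.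
Proof.
induction n as [n IH] using lt_wf_ind; intros Hn.
destruct (classic (nat_prime n)) as [|Hnot]; [exists n; split; auto with arith|].
- apply Nat.divide_refl.
- destruct (classic (exists d, Nat.divide d n /\ d <> 1%nat /\ d <> n))
    as [(d & Hd & H1 & Hdn)|Hnone].
  + assert (d <= n)%nat by (apply Nat.divide_pos_le; [lia|assumption]).
    destruct d as [|[|d]]; [destruct Hd; lia|lia|].
    destruct (IH (S (S d))) as (p & Hp & Hpd); [lia..|].
    exists p; split; [assumption|]; now apply Nat.divide_trans with (S (S d)).
  + exfalso; apply Hnot; split; [assumption|]; intros d Hd.
    destruct (Nat.eq_dec d 1); [now left|]; destruct (Nat.eq_dec d n); [now right|].
    exfalso; apply Hnone; now exists d.
Qed.

Lemma nat_prime_gcd (p q : nat) :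
  nat_prime p -> nat_prime q -> p <> q -> Nat.gcd p q = 1%nat.
Proof.
intros [Hp Dp] [Hq Dq] Hpq.
destruct (Dp (Nat.gcd p q) (Nat.gcd_divide_l p q)) as [|E]; [assumption|].
destruct (Dq (Nat.gcd p q) (Nat.gcd_divide_r p q)); congruence.
Qed.

Lemma divide_mul_of_gcd_1 (p m n : nat) :
  Nat.gcd p m = 1%nat -> Nat.divide p n -> Nat.divide m n -> Nat.divide (p * m) n.
Proof.
intros G Hp [c ->].
rewrite Nat.mul_comm in Hp; destruct (Nat.gauss _ _ _ Hp G) as [e ->].
exists e; lia.
Qed.

Lemma gcd_mul_1 (p m n : nat) :
  Nat.gcd p m = 1%nat -> Nat.gcd p n = 1%nat -> Nat.gcd p (m * n) = 1%nat.
Proof.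
intros Gm Gn.
apply Nat.divide_1_r; rewrite <- Gn; apply Nat.gcd_greatest;
  [apply Nat.gcd_divide_l|].
apply Nat.gauss with m; [apply Nat.gcd_divide_r|].
apply Nat.divide_1_r; rewrite <- Gm; apply Nat.gcd_greatest;
  [|apply Nat.gcd_divide_r].
eapply Nat.divide_trans; apply Nat.gcd_divide_l.
Qed.

(** * Legendre's sieve for pairwise coprime moduli *)

Definition avoids (ps : list nat) (u : nat) : bool :=
  forallb (fun p => negb (u mod p =? 0)%nat) ps.

Fixpoint count_avoiding (ps : list nat) (x : nat) : nat :=
  match x with
  | 0%nat => 0
  | S x' => (if avoids ps x then 1 else 0) + count_avoiding ps x'
  end%nat.

Lemma mod_eqb_divide (u p : nat) : (u mod p =? 0)%nat = true <-> Nat.divide p u.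
Proof. now rewrite Nat.eqb_eq, Nat.Lcm0.mod_divide. Qed.

Lemma avoids_mul (p u : nat) (ps : list nat) :
  Forall (fun q => Nat.gcd q p = 1%nat) ps -> avoids ps (p * u) = avoids ps u.
Proof.
induction 1 as [|q ps Hq _ IH]; [reflexivity|]; simpl; rewrite IH.
do 2 f_equal; apply eq_true_iff_eq; rewrite !mod_eqb_divide; split; intros H.
- now apply Nat.gauss with p.
- now apply Nat.divide_mul_r.
Qed.

(* Legendre's recursion: the multiples of [p] counted by [count_avoiding ps x]
   are the [p * u] with [u] counted by [count_avoiding ps (x / p)]. *)
Lemma count_avoiding_cons (p : nat) (ps : list nat) (x : nat) :
  (0 < p)%nat -> Forall (fun q => Nat.gcd q p = 1%nat) ps ->
  (count_avoiding (p :: ps) x + count_avoiding ps (x / p) = count_avoiding ps x)%nat.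
Proof.
intros Hp Hps; induction x as [|x IH].
- rewrite Nat.Div0.div_0_l; reflexivity.
- simpl count_avoiding at 1 3; cbn [avoids forallb].
  fold (avoids ps (S x)).
  assert (Dx := Nat.div_mod_eq x p); assert (Mx := Nat.mod_upper_bound x p ltac:(lia)).
  destruct (S x mod p =? 0)%nat eqn:E.
  + apply mod_eqb_divide in E; destruct E as [c Ec].
    assert (Hc : (0 < c)%nat) by (destruct c; lia).
    assert (Ex : (x / p = c - 1)%nat) by (symmetry; apply Nat.div_unique with (p - 1)%nat; nia).
    assert (ESx : (S x / p = S (c - 1))%nat)
      by (symmetry; apply Nat.div_unique with 0%nat; nia).
    rewrite ESx; rewrite Ex in IH; simpl count_avoiding.
    replace (S (c - 1))%nat with c by lia.
    rewrite Ec, Nat.mul_comm, avoids_mul by assumption.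
    simpl; lia.
  + assert (ESx : (S x / p = x / p)%nat).
    { apply Nat.eqb_neq in E.
      symmetry; apply Nat.div_unique with (S (x mod p)); [|lia].
      destruct (Nat.eq_dec (S (x mod p)) p) as [Ep|]; [|lia].
      exfalso; apply E, Nat.Lcm0.mod_divide.
      exists (S (x / p)); nia. }
    rewrite ESx; simpl; lia.
Qed.

Lemma count_avoiding_witness (ps : list nat) (x y : nat) :
  (count_avoiding ps x < count_avoiding ps y)%nat ->
  exists u, (x < u <= y)%nat /\ avoids ps u = true.
Proof.
induction y as [|y IH]; intros H; [simpl in H; lia|].
destruct (avoids ps (S y)) eqn:E.
- destruct (Nat.lt_ge_cases x (S y)) as [|L]; [exists (S y); split; [lia|assumption]|].
  exfalso; revert H; apply Nat.le_ngt.
  clear - L; induction L as [|x L IH]; [lia|].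
  apply (Nat.le_trans _ _ _ IH); simpl; lia.
- simpl in H; rewrite E in H; destruct IH as (u & Hu & Eu); [lia|].
  exists u; split; [lia|assumption].
Qed.

Definition product (ps : list nat) : nat := fold_right Nat.mul 1%nat ps.

(** For distinct primes this is Euler's totient of their product. *)
Definition euler_product (ps : list nat) : nat :=
  fold_right (fun p r => ((p - 1) * r)%nat) 1%nat ps.

Lemma euler_product_le (ps : list nat) : (euler_product ps <= product ps)%nat.
Proof. induction ps; simpl; nia. Qed.

Local Open Scope Z_scope.

(** The expected density is [euler_product ps / product ps], with denominators cleared. Each new
    modulus subtracts a second count, which doubles the error bound, and its rounding adds one more;
    hence [2 ^ k - 1]. *)
Lemma legendre_bound (ps : list nat) :
  ForallOrdPairs (fun p q => Nat.gcd q p = 1%nat) ps ->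
  Forall (fun p => (0 < p)%nat) ps ->
  forall x y : nat, (x <= y)%nat ->
  Z.abs ((Z.of_nat (count_avoiding ps y) - Z.of_nat (count_avoiding ps x)) *
           Z.of_nat (product ps) -
         Z.of_nat (y - x) * Z.of_nat (euler_product ps))
    <= (2 ^ Z.of_nat (length ps) - 1) * Z.of_nat (product ps).
Proof.
induction 1 as [|p ps Hp _ IH]; intros Hpos x y Hxy.
- assert (C : forall z, count_avoiding nil z = z) by (induction z; simpl; congruence).
  rewrite !C; simpl; lia.
- inversion_clear Hpos as [|? ? Hp0 Hps].
  assert (Cx := count_avoiding_cons p ps x Hp0 Hp).
  assert (Cy := count_avoiding_cons p ps y Hp0 Hp).
  assert (B1 := IH Hps x y Hxy).
  assert (Hdiv : (x / p <= y / p)%nat) by (apply Nat.Div0.div_le_mono; assumption).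
  assert (B2 := IH Hps (x / p)%nat (y / p)%nat Hdiv).
  assert (Dx := Nat.div_mod_eq x p); assert (Mx := Nat.mod_upper_bound x p ltac:(lia)).
  assert (Dy := Nat.div_mod_eq y p); assert (My := Nat.mod_upper_bound y p ltac:(lia)).
  assert (HF := euler_product_le ps).
  cbn [length product euler_product fold_right];
    fold (product ps) (euler_product ps).
  rewrite Nat2Z.inj_succ, Z.pow_succ_r by lia.
  revert B1 B2.
  replace (Z.of_nat (count_avoiding (p :: ps) x)) with
    (Z.of_nat (count_avoiding ps x) - Z.of_nat (count_avoiding ps (x / p))) by lia.
  replace (Z.of_nat (count_avoiding (p :: ps) y)) with
    (Z.of_nat (count_avoiding ps y) - Z.of_nat (count_avoiding ps (y / p))) by lia.
  rewrite !Nat2Z.inj_mul, !Nat2Z.inj_sub by lia.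
  generalize (Z.of_nat (count_avoiding ps x)) (Z.of_nat (count_avoiding ps y))
    (Z.of_nat (count_avoiding ps (x / p))) (Z.of_nat (count_avoiding ps (y / p)))
    (2 ^ Z.of_nat (length ps)).
  intros cx cy dx dy K B1 B2.
  assert (F0 : 0 <= Z.of_nat (euler_product ps) <= Z.of_nat (product ps)) by lia.
  revert B1 B2 F0.
  generalize (Z.of_nat (product ps)) (Z.of_nat (euler_product ps)).
  intros P F B1 B2 F0.
  assert (Hq : Z.abs (Z.of_nat p * (Z.of_nat (y / p) - Z.of_nat (x / p)) -
      (Z.of_nat y - Z.of_nat x)) <= Z.of_nat p).
  { assert (Z.of_nat y = Z.of_nat p * Z.of_nat (y / p) + Z.of_nat (y mod p)) by nia.
    assert (Z.of_nat x = Z.of_nat p * Z.of_nat (x / p) + Z.of_nat (x mod p)) by nia.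
    lia. }
  revert Hq B1 B2.
  generalize (Z.of_nat (y / p)) (Z.of_nat (x / p)) (Z.of_nat y) (Z.of_nat x).
  intros yp xp y' x' Hq B1 B2.
  assert (Hp1 : 0 < Z.of_nat p) by lia; revert Hp1 Hq.
  change (Z.of_nat 1) with 1.
  generalize (Z.of_nat p); intros p' Hp1 Hq.
  (* [e1] and [e2] are the sieve errors on the original and on the divided interval, [e3] is the
     rounding error of the division by [p']. *)
  set (e1 := (cy - cx) * P - (y' - x') * F) in *.
  set (e2 := (dy - dx) * P - (yp - xp) * F) in *.
  set (e3 := p' * (yp - xp) - (y' - x')) in *.
  replace ((cy - dy - (cx - dx)) * (p' * P) - (y' - x') * ((p' - 1) * F))
    with (p' * e1 - p' * e2 - e3 * F) by (unfold e1, e2, e3; ring).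
  clearbody e1 e2 e3.
  apply Z.abs_le in B1, B2, Hq; apply Z.abs_le.
  assert (p' * - ((K - 1) * P) <= p' * e1 <= p' * ((K - 1) * P))
    by (split; apply Z.mul_le_mono_nonneg_l; lia).
  assert (p' * - ((K - 1) * P) <= p' * e2 <= p' * ((K - 1) * P))
    by (split; apply Z.mul_le_mono_nonneg_l; lia).
  assert (- (p' * P) <= e3 * F <= p' * P) by nia.
  lia.
Qed.

(** * The number of prime divisors against the totient *)

Lemma nat_prime_neq_4 (p : nat) : nat_prime p -> p <> 4%nat.
Proof.
intros [_ D] ->; destruct (D 2%nat); [exists 2%nat; reflexivity|lia..].
Qed.

(** The new entry multiplies the left side by [4 * p] and the squared totient by [(p - 1) ^ 2];
    passing from [c'] to [c] absorbs the ratio. The leading factor 4 keeps the successive constants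
    4, 5, 15, 120 integral. *)
Lemma totient_ratio_cons (p : nat) (ps : list nat) (c c' : Z) :
  (0 < p)%nat -> 4 * Z.of_nat p * c' <= c * (Z.of_nat p - 1) ^ 2 ->
  4 * (4 ^ Z.of_nat (length ps) * Z.of_nat (product ps)) <=
    c' * Z.of_nat (euler_product ps) ^ 2 ->
  4 * (4 ^ Z.of_nat (length (p :: ps)) * Z.of_nat (product (p :: ps))) <=
    c * Z.of_nat (euler_product (p :: ps)) ^ 2.
Proof.
cbn [length product euler_product fold_right];
  fold (product ps) (euler_product ps); intros Hp Hc H.
rewrite Nat2Z.inj_succ, Z.pow_succ_r, !Nat2Z.inj_mul, Z.pow_mul_l, Nat2Z.inj_sub by lia.
change (Z.of_nat 1) with 1.
transitivity (4 * Z.of_nat p * (c' * Z.of_nat (euler_product ps) ^ 2)).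
- replace (4 * (4 * 4 ^ Z.of_nat (length ps) * (Z.of_nat p * Z.of_nat (product ps))))
    with (4 * Z.of_nat p * (4 * (4 ^ Z.of_nat (length ps) * Z.of_nat (product ps)))) by ring.
  apply Z.mul_le_mono_nonneg_l; lia.
- rewrite !Z.mul_assoc; apply Z.mul_le_mono_nonneg_r; lia.
Qed.

(** From 6 on, [4 * p <= (p - 1) ^ 2], so no entry costs anything. *)
Lemma totient_ratio_ge_6 (ps : list nat) :
  Forall (le 6) ps ->
  4 * (4 ^ Z.of_nat (length ps) * Z.of_nat (product ps)) <=
    4 * Z.of_nat (euler_product ps) ^ 2.
Proof.
induction 1 as [|p ps Hp _ IH]; [simpl; lia|].
apply totient_ratio_cons with 4; [lia|nia|assumption].
Qed.

(* Among primes only 2, 3 and 5 contribute a factor [(p - 1)^2 / (4 p) < 1],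
   namely 1/8, 1/3 and 4/5; their product is 1/30. *)
Lemma totient_ratio (ps : list nat) :
  StronglySorted lt ps -> Forall nat_prime ps ->
  4 ^ Z.of_nat (length ps) * Z.of_nat (product ps) <=
  30 * Z.of_nat (euler_product ps) ^ 2.
Proof.
intros Hs Hp.
assert (above : forall k p qs, (k < p)%nat \/ k = p -> StronglySorted lt (p :: qs) ->
  Forall nat_prime (p :: qs) ->
  StronglySorted lt qs /\ Forall nat_prime qs /\ Forall (le (S k)) qs /\
  ((k < p)%nat -> Forall (le (S k)) (p :: qs))).
{ intros k p qs Hk S1 S2; apply StronglySorted_inv in S1; destruct S1 as [S1 S3].
  inversion_clear S2 as [|? ? _ S4].
  assert (Forall (le (S k)) qs) by (apply Forall_impl with (2 := S3); lia).
  repeat split; auto. }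
assert (L5 : forall qs, StronglySorted lt qs -> Forall nat_prime qs -> Forall (le 5) qs ->
  4 * (4 ^ Z.of_nat (length qs) * Z.of_nat (product qs)) <=
    5 * Z.of_nat (euler_product qs) ^ 2).
{ intros [|p qs] S1 S2 S3; [simpl; lia|].
  assert (p5 : (5 <= p)%nat) by now inversion_clear S3.
  destruct (above 5%nat p qs) as (_ & _ & T1 & T2); [lia|assumption..|].
  destruct (Nat.eq_dec p 5) as [->|].
  - apply totient_ratio_cons with 4; [lia|lia|].
    now apply totient_ratio_ge_6.
  - assert (H := totient_ratio_ge_6 (p :: qs) (T2 ltac:(lia))); nia. }
assert (L3 : forall qs, StronglySorted lt qs -> Forall nat_prime qs -> Forall (le 3) qs ->
  4 * (4 ^ Z.of_nat (length qs) * Z.of_nat (product qs)) <=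
    15 * Z.of_nat (euler_product qs) ^ 2).
{ intros qs S1 S2 S3.
  assert (no4 : forall rs, Forall nat_prime rs -> Forall (le 4) rs -> Forall (le 5) rs).
  { intros rs R1 R2; rewrite Forall_forall in *; intros r Hr.
    assert (r <> 4%nat) by (apply nat_prime_neq_4; auto).
    specialize (R2 r Hr); lia. }
  destruct qs as [|p qs]; [simpl; lia|].
  assert (p3 : (3 <= p)%nat) by now inversion_clear S3.
  destruct (above 3%nat p qs) as (T0 & T0' & T1 & T2); [lia|assumption..|].
  destruct (Nat.eq_dec p 3) as [->|].
  - apply totient_ratio_cons with 5; [lia|lia|]; auto.
  - assert (H := L5 (p :: qs) S1 S2 (no4 _ S2 (T2 ltac:(lia)))); nia. }
enough (4 * (4 ^ Z.of_nat (length ps) * Z.of_nat (product ps)) <=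
    120 * Z.of_nat (euler_product ps) ^ 2) by lia.
destruct ps as [|p ps]; [simpl; lia|].
assert (p2 : (2 <= p)%nat) by (inversion_clear Hp as [|? ? [? _] _]; lia).
destruct (above 2%nat p ps) as (T0 & T0' & T1 & T2); [lia|assumption..|].
destruct (Nat.eq_dec p 2) as [->|].
- apply totient_ratio_cons with 15; [lia|lia|]; auto.
- assert (H := L3 (p :: ps) Hs Hp (T2 ltac:(lia))); nia.
Qed.

(** * The window for large [n] *)

(** Increasing order makes the primes distinct, hence pairwise coprime, and lets 2, 3 and 5 be split
    off at the head. *)
Lemma sorted_prime_divisors (n d lo : nat) :
  exists ps, StronglySorted lt ps /\
    forall p, In p ps <-> (lo <= p < lo + d)%nat /\ nat_prime p /\ Nat.divide p n.
Proof.
revert lo; induction d as [|d IH]; intros lo.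
- exists nil; split; [constructor|]; intros p; split; [intros []|lia].
- destruct (IH (S lo)) as (ps & Hs & Hin).
  destruct (classic (nat_prime lo /\ Nat.divide lo n)) as [C|C].
  + exists (lo :: ps); split.
    * constructor; [assumption|]; apply Forall_forall; intros p Hp.
      apply Hin in Hp; lia.
    * intros p; simpl; rewrite Hin; split.
      -- intros [<-|]; intuition lia.
      -- destruct (Nat.eq_dec lo p); intuition lia.
  + exists ps; split; [assumption|]; intros p; rewrite Hin.
    destruct (Nat.eq_dec lo p) as [->|]; intuition lia.
Qed.

Lemma sorted_primes_pairwise_coprime (ps : list nat) :
  StronglySorted lt ps -> Forall nat_prime ps ->
  ForallOrdPairs (fun p q => Nat.gcd q p = 1%nat) ps.
Proof.
induction 1 as [|p ps _ IH Hp]; intros H; constructor; inversion_clear H; auto.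
rewrite Forall_forall in *; intros q Hq.
apply nat_prime_gcd; auto; specialize (Hp q Hq); lia.
Qed.

Lemma product_divide (n : nat) (ps : list nat) :
  ForallOrdPairs (fun p q => Nat.gcd q p = 1%nat) ps ->
  Forall (fun p => Nat.divide p n) ps -> Nat.divide (product ps) n.
Proof.
induction 1 as [|p ps Hp _ IH]; intros H; [apply Nat.divide_1_l|].
inversion_clear H as [|? ? Hpn Hps].
apply divide_mul_of_gcd_1; auto.
clear - Hp; induction Hp as [|q ps Hq _ IH]; [apply Nat.divide_1_r, Nat.gcd_divide_r|].
apply gcd_mul_1; [now rewrite Nat.gcd_comm|assumption].
Qed.

(** The sieve runs over the prime divisors of [n], whose product is at most [n]. The threshold is
    [30 * 352 ^ 2]: 30 comes from [totient_ratio], 352 from the window length [n / 352]. *)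
Lemma coprime_in_window_large (n : nat) :
  3717120 < Z.of_nat n ->
  exists q, Nat.gcd q n = 1%nat /\ (n < 11 * q)%nat /\ (32 * q < 3 * n)%nat.
Proof.
intros Hn.
destruct (sorted_prime_divisors n n 1) as (ps & Hs & Hin).
assert (Hprime : Forall nat_prime ps) by (apply Forall_forall; intros p; now rewrite Hin).
assert (Hdiv : Forall (fun p => Nat.divide p n) ps)
  by (apply Forall_forall; intros p; now rewrite Hin).
assert (Hcop := sorted_primes_pairwise_coprime ps Hs Hprime).
assert (Hpos : Forall (fun p => (0 < p)%nat) ps)
  by (apply Forall_impl with (2 := Hprime); intros p [? _]; lia).
assert (HP : (product ps <= n)%nat)
  by (apply Nat.divide_pos_le; [lia|]; now apply product_divide).
assert (HP0 : (0 < product ps)%nat)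
  by (clear - Hpos; induction Hpos; simpl; nia).
(* The integers [u] with [x < u <= y] are exactly those of the window. *)
set (x := (n / 11)%nat); set (y := ((3 * n - 1) / 32)%nat).
assert (Dx := Nat.div_mod_eq n 11); assert (Mx := Nat.mod_upper_bound n 11 ltac:(lia)).
assert (Dy := Nat.div_mod_eq (3 * n - 1) 32);
  assert (My := Nat.mod_upper_bound (3 * n - 1) 32 ltac:(lia)).
fold x in Dx; fold y in Dy.
assert (Hxy : (x <= y)%nat) by lia.
assert (Hlen : Z.of_nat n - 352 <= 352 * Z.of_nat (y - x)) by lia.
assert (B := legendre_bound ps Hcop Hpos x y Hxy).
assert (T := totient_ratio ps Hs Hprime).
assert (HF := euler_product_le ps).
assert (Hcount : (count_avoiding ps x < count_avoiding ps y)%nat).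
{ revert B T Hlen.
  assert (E4 : 4 ^ Z.of_nat (length ps) =
    2 ^ Z.of_nat (length ps) * 2 ^ Z.of_nat (length ps))
    by (now rewrite <- Z.pow_mul_l).
  rewrite E4.
  assert (K0 : 0 < 2 ^ Z.of_nat (length ps)) by lia.
  revert K0; generalize (2 ^ Z.of_nat (length ps)) (Z.of_nat (y - x)).
  intros K L K0 B T Hlen.
  assert (Hz : Z.of_nat (euler_product ps) <= Z.of_nat (product ps) <= Z.of_nat n) by lia.
  assert (0 < Z.of_nat (product ps)) by lia.
  apply Nat2Z.inj_lt.
  assert (0 <= Z.of_nat (euler_product ps)) by lia.
  revert Hz H H0 B T Hlen Hn; clear.
  generalize (Z.of_nat (euler_product ps)) (Z.of_nat (product ps)) (Z.of_nat n)
    (Z.of_nat (count_avoiding ps x)) (Z.of_nat (count_avoiding ps y)).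
  intros F P N cx cy Hz HP HF B T HL HN.
  (* The main term beats the sieve error: otherwise squaring and using [K * K * P <= 30 * F ^ 2] and
     [P <= N] would give [N <= 30 * 352 ^ 2]. *)
  assert (HNF : 352 * (K * P) < N * F).
  { destruct (Z.lt_ge_cases (352 * (K * P)) (N * F)) as [|G]; [assumption|exfalso].
    assert (G2 : (N * F) * (N * F) <= (352 * (K * P)) * (352 * (K * P)))
      by (apply Z.mul_le_mono_nonneg; nia).
    assert (G3 : N * N * (K * K * P) <= N * N * (30 * F ^ 2))
      by (apply Z.mul_le_mono_nonneg_l; nia).
    assert (G4 : N * P * (K * K * P) <= N * N * (K * K * P))
      by (apply Z.mul_le_mono_nonneg_r; nia).
    assert (G5 : 0 < K * K * P * P) by nia.
    assert (G6 : (N - 3717120) * (K * K * P * P) <= 0) by lia.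
    nia. }
  assert (G1 : (N - 352) * F <= 352 * L * F) by (apply Z.mul_le_mono_nonneg_r; lia).
  apply Z.abs_le in B.
  assert (G2 : 0 < (cy - cx) * P) by lia.
  nia. }
destruct (count_avoiding_witness ps x y Hcount) as (q & Hq & Ha).
exists q; split; [|lia].
destruct (Nat.eq_dec (Nat.gcd q n) 1) as [|G]; [assumption|exfalso].
destruct (nat_prime_divisor (Nat.gcd q n)) as (p & Hp & Hpg).
{ assert (Nat.gcd q n <> 0%nat) by (intros E; apply Nat.gcd_eq_0 in E; lia); lia. }
assert (Hpq : Nat.divide p q) by (apply Nat.divide_trans with (1 := Hpg), Nat.gcd_divide_l).
assert (Hpn : Nat.divide p n) by (apply Nat.divide_trans with (1 := Hpg), Nat.gcd_divide_r).
assert (p <= n)%nat by (apply Nat.divide_pos_le; [lia|assumption]).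
assert (Hp1 : (1 < p)%nat) by apply Hp.
unfold avoids in Ha; rewrite forallb_forall in Ha.
assert (Hi : In p ps) by (apply Hin; intuition lia).
specialize (Ha p Hi).
apply mod_eqb_divide in Hpq; rewrite Hpq in Ha; discriminate.
Qed.

(** * Computation for the remaining [n] *)

(** Trial division up to the square root. Exhausted fuel answers [false], so [true] is
    conclusive. *)
Fixpoint no_divisor_from (fuel : nat) (d q : Z) : bool :=
  match fuel with
  | O => false
  | S f =>
      if q <? d * d then true
      else if q mod d =? 0 then false else no_divisor_from f (d + 1) q
  end.

(** Only a search: out of fuel it may return a composite number, so [prime_windows_cover] tests the
    result again. *)
Fixpoint prime_at_most (fuel : nat) (q : Z) : Z :=
  match fuel with
  | O => q
  | S f => if no_divisor_from 1000 2 q then q else prime_at_most f (q - 1)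
  end.

(* A prime [q] is coprime to every [n] with [32 q < 3 n < 33 q], since the
   multiples of [q] are not in this range; the primes chosen here have ranges
   that cover [(lo, hi]]. *)
Fixpoint prime_windows_cover (fuel : nat) (lo hi : Z) : bool :=
  if hi <=? lo then true else
  match fuel with
  | O => false
  | S f =>
      let q := prime_at_most 200 ((3 * lo + 2) / 32) in
      if no_divisor_from 1000 2 q then
        if 32 * q <? 3 * (lo + 1) then
          if 1 <? q then prime_windows_cover f (11 * q - 1) hi else false
        else false
      else false
  end.

Lemma no_divisor_from_correct (fuel : nat) (d q : Z) :
  2 <= d -> no_divisor_from fuel d q = true ->
  (forall e, 2 <= e < d -> ~ (e | q)) -> forall e, 2 <= e < q -> ~ (e | q).
Proof.
revert d; induction fuel as [|fuel IH]; simpl; [discriminate|].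
intros d Hd; destruct (Z.ltb_spec q (d * d)) as [L|_].
- intros _ H e He [k Hk].
  destruct (Z.lt_ge_cases e d) as [|He']; [apply (H e); [lia|now exists k]|].
  (* As [q < d * d] and [d <= e < q], the cofactor [k] is a divisor with [2 <= k < d]. *)
  apply (H k); [nia|exists e; lia].
- destruct (Z.eqb_spec (q mod d) 0) as [|E]; [discriminate|].
  intros Hf H; apply (IH (d + 1)); [lia|assumption|].
  intros e He Hdiv; destruct (Z.eq_dec e d) as [->|]; [|apply (H e); [lia|assumption]].
  apply E, Z.mod_divide; [lia|assumption].
Qed.

Lemma coprime_of_prime_window (q n : nat) :
  1 < Z.of_nat q -> (forall e, 2 <= e < Z.of_nat q -> ~ (e | Z.of_nat q)) ->
  32 * Z.of_nat q < 3 * Z.of_nat n -> Z.of_nat n < 11 * Z.of_nat q ->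
  Nat.gcd q n = 1%nat.
Proof.
intros Hq Hprime L1 L2.
destruct (Nat.gcd_divide q n) as [[k Hk] [l Hl]].
remember (Nat.gcd q n) as g eqn:Eg; clear Eg.
destruct (Nat.eq_dec g q) as [->|].
{ exfalso; destruct (Nat.le_gt_cases l 10); nia. }
destruct (Z.lt_ge_cases 1 (Z.of_nat g)) as [G|G]; [exfalso|destruct g as [|[|g]]; lia].
apply (Hprime (Z.of_nat g)); [|exists (Z.of_nat k); lia].
destruct k as [|[|k]]; nia.
Qed.

Lemma prime_windows_cover_correct (fuel : nat) (lo hi : Z) :
  prime_windows_cover fuel lo hi = true ->
  forall n : nat, lo < Z.of_nat n <= hi ->
  exists q, Nat.gcd q n = 1%nat /\ (n < 11 * q)%nat /\ (32 * q < 3 * n)%nat.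
Proof.
revert lo; induction fuel as [|fuel IH]; intros lo; cbn [prime_windows_cover];
  destruct (Z.leb_spec hi lo); try discriminate; try lia.
generalize (prime_at_most 200 ((3 * lo + 2) / 32)); cbv zeta; intros q.
destruct (no_divisor_from 1000 2 q) eqn:E; [|discriminate].
destruct (Z.ltb_spec (32 * q) (3 * (lo + 1))); [|discriminate].
destruct (Z.ltb_spec 1 q); [|discriminate].
intros Hf n Hn.
destruct (Z.lt_ge_cases (11 * q - 1) (Z.of_nat n)); [apply (IH (11 * q - 1)); [assumption|lia]|].
exists (Z.to_nat q); split; [|lia].
apply coprime_of_prime_window; rewrite ?Z2Nat.id; try lia.
apply no_divisor_from_correct with (2 := E); lia.
Qed.

(** Applied up to 6000, where a window holds at most 18 integers, so the twenty candidates above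
    [n / 11] exhaust it. Here [q] may be composite. *)
Definition small_windows (lo hi : Z) : bool :=
  forallb (fun j =>
    let n := lo + Z.of_nat j in
    existsb (fun i =>
        let q := n / 11 + Z.of_nat i in
        (Z.gcd q n =? 1) && (32 * q <? 3 * n)) (seq 1 20))
    (seq 1 (Z.to_nat (hi - lo))).

Lemma small_windows_correct (lo hi : Z) (n : nat) :
  small_windows lo hi = true -> lo < Z.of_nat n <= hi ->
  exists q, Nat.gcd q n = 1%nat /\ (n < 11 * q)%nat /\ (32 * q < 3 * n)%nat.
Proof.
unfold small_windows; rewrite forallb_forall; intros H Hn.
specialize (H (Z.to_nat (Z.of_nat n - lo))); rewrite in_seq in H.
specialize (H ltac:(lia)).
replace (lo + Z.of_nat (Z.to_nat (Z.of_nat n - lo))) with (Z.of_nat n) in H by lia.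
apply existsb_exists in H; destruct H as (i & Hi & H).
apply in_seq in Hi; apply andb_true_iff in H; destruct H as [Hg Hw].
apply Z.eqb_eq in Hg; apply Z.ltb_lt in Hw.
assert (D := Z.div_mod (Z.of_nat n) 11 ltac:(lia)).
assert (B := Z.mod_pos_bound (Z.of_nat n) 11 ltac:(lia)).
exists (Z.to_nat (Z.of_nat n / 11 + Z.of_nat i)); split; [|lia].
rewrite <- (Z2Nat.id (_ + _)) in Hg by lia.
destruct (Nat.gcd_divide (Z.to_nat (Z.of_nat n / 11 + Z.of_nat i)) n)
  as [[k' Hk] [l Hl]].
set (g := Nat.gcd _ n) in *; clearbody g.
assert (G : (Z.of_nat g | 1)).
{ rewrite <- Hg; apply Z.gcd_greatest; [exists (Z.of_nat k')|exists (Z.of_nat l)]; lia. }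
apply Z.divide_1_r_nonneg in G; lia.
Qed.

Lemma coprime_in_window (n : nat) :
  (1674 < n)%nat ->
  exists q, Nat.gcd q n = 1%nat /\ (n < 11 * q)%nat /\ (32 * q < 3 * n)%nat.
Proof.
intros Hn; destruct (Z.le_gt_cases (Z.of_nat n) 6000).
{ apply (small_windows_correct 1674 6000); [vm_compute; reflexivity|lia]. }
destruct (Z.le_gt_cases (Z.of_nat n) 3717120).
- apply (prime_windows_cover_correct 400 6000 3717120); [vm_compute; reflexivity|lia].
- apply coprime_in_window_large; lia.
Qed.

Local Close Scope Z_scope.

(** * Returns to the maximum *)

Definition recurrence (y : nat -> R) : Prop :=
  forall i, y (i + 4)%nat =
    Rmax (y (i + 3)%nat) (Rmax (y (i + 2)%nat) (Rmax (y (i + 1)%nat) 0)) - y i.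

Definition state (x : nat -> R) (n : nat) : R * R * R * R :=
  (x n, x (n + 1)%nat, x (n + 2)%nat, x (n + 3)%nat).

(** As the phase grows, the moving value climbs from 0 to [B] in the last place, descends from [B]
    to [A] in the middle, then climbs from [A] towards [M] in the place after the maximum. Adjacent
    branches agree at their common endpoint, and the limit [(M, M, A, B)] is followed by
    [(M, A, B, 0)], of phase 0: this closes the circle. *)
Definition section_point (M A B th : R) : R * R * R * R :=
  if Rle_dec th B then (M, A, B, th)
  else if Rle_dec th (2 * B - A) then (M, A, 2 * B - th, B)
  else (M, th - 2 * (B - A), A, B).

(** Turns the maximum into linear conditions, an upper bound that is attained, so that a guessed
    term can be checked by [lra]. *)
Lemma next_value (y : nat -> R) (j : nat) (t : R) :
  recurrence y ->
  y (j + 1)%nat <= t + y j -> y (j + 2)%nat <= t + y j ->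
  y (j + 3)%nat <= t + y j -> 0 <= t + y j ->
  t + y j <= y (j + 1)%nat \/ t + y j <= y (j + 2)%nat \/
  t + y j <= y (j + 3)%nat \/ t + y j <= 0 ->
  y (j + 4)%nat = t.
Proof.
intros H; rewrite H; unfold Rmax; intros.
repeat destruct Rle_dec; lra.
Qed.

Lemma quadruple_eq (a b c d a' b' c' d' : R) :
  a = a' -> b = b' -> c = c' -> d = d' -> (a, b, c, d) = (a', b', c', d').
Proof. now intros -> -> -> ->. Qed.

Ltac some_disjunct :=
  first [lra | left; lra | right; some_disjunct].

Ltac next_values y H j v :=
  let k := eval simpl in (j + 4)%nat in
  assert (y k = v)
    by (apply (next_value y j v H); simpl Nat.add; some_disjunct).

Ltac solve_section :=
  unfold section_point; repeat destruct Rle_dec; try (exfalso; lra);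
  apply quadruple_eq; lra.

Ltac no_early_return :=
  unfold section_point; intros j th' Hj Hth';
  do 11 (destruct j as [|j]; [try lia; simpl; repeat destruct Rle_dec; intros [=]; lra|]); lia.

(** In each case the ordering decides every maximum, so the orbit is an explicit list of linear
    terms. If [B - A = M], then [A = 0] and [B = M], and the section can be met earlier; the last
    clause therefore assumes [B - A < M]. *)
Lemma first_return (y : nat -> R) (M A B th : R) :
  recurrence y ->
  0 <= A -> A < B -> B <= M -> 0 <= th < M + 2 * (B - A) ->
  state y 0 = section_point M A B th ->
  exists (r w : nat),
    (r + w = 11)%nat /\
    (w = 1%nat /\ th < B - A \/ w = 0%nat /\ B - A <= th) /\
    state y r = section_point M A B (th - (B - A) + INR w * (M + 2 * (B - A))) /\
    (B - A < M -> forall j th', (0 < j < r)%nat ->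
       0 <= th' < M + 2 * (B - A) -> state y j <> section_point M A B th').
Proof.
intros H HA HAB HBM [th0 th1] Hst.
unfold state in *; simpl in Hst; unfold section_point in Hst.
destruct (Rle_dec th B); [|destruct (Rle_dec th (2 * B - A))];
  injection Hst; intros E3 E2 E1 E0.
- next_values y H 0%nat (B - M).
  next_values y H 1%nat (B - A).
  destruct (Rlt_dec th (B - A)).
  + next_values y H 2%nat (- A).
    next_values y H 3%nat (B - A - th).
    next_values y H 4%nat (M - A).
    next_values y H 5%nat (M - B).
    next_values y H 6%nat M.
    next_values y H 7%nat (M - (B - A) + th).
    next_values y H 8%nat A.
    next_values y H 9%nat B.
    (* The phase wraps past 0: the state is [(M, M - (B - A) + th, A, B)], in the third branch, one
       step sooner than otherwise. *)
    exists 10%nat, 1%nat; split; [lia|]; split; [left; split; [reflexivity|lra]|]; split.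
    * simpl; solve_section.
    * intros HM; no_early_return.
  + next_values y H 2%nat (th - B).
    next_values y H 3%nat (B - A - th).
    next_values y H 4%nat (M - A).
    next_values y H 5%nat (M - B).
    next_values y H 6%nat (M + (B - A) - th).
    next_values y H 7%nat M.
    next_values y H 8%nat A.
    next_values y H 9%nat B.
    next_values y H 10%nat (th - (B - A)).
    exists 11%nat, 0%nat; split; [lia|]; split; [right; split; [reflexivity|lra]|]; split.
    * simpl; solve_section.
    * intros HM; no_early_return.
- next_values y H 0%nat (B - M).
  next_values y H 1%nat (B - A).
  next_values y H 2%nat (th - B).
  next_values y H 3%nat (- A).
  next_values y H 4%nat (M - A).
  next_values y H 5%nat (M - B).
  next_values y H 6%nat (M - A + B - th).
  next_values y H 7%nat M.
  next_values y H 8%nat A.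
  next_values y H 9%nat B.
  next_values y H 10%nat (th - (B - A)).
  exists 11%nat, 0%nat; split; [lia|]; split; [right; split; [reflexivity|lra]|]; split.
  * simpl; solve_section.
  * intros HM; no_early_return.
- destruct (Rle_dec (th - 2 * (B - A)) B).
  + next_values y H 0%nat (B - M).
    next_values y H 1%nat (B - (th - 2 * (B - A))).
    next_values y H 2%nat (B - A).
    next_values y H 3%nat (- A).
    next_values y H 4%nat (M - A).
    next_values y H 5%nat (M - A - B + (th - 2 * (B - A))).
    next_values y H 6%nat (M - B).
    next_values y H 7%nat M.
    next_values y H 8%nat A.
    next_values y H 9%nat (A + B - (th - 2 * (B - A))).
    next_values y H 10%nat B.
    exists 11%nat, 0%nat; split; [lia|]; split; [right; split; [reflexivity|lra]|]; split.
    * simpl; solve_section.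
    * intros HM; no_early_return.
  + next_values y H 0%nat ((th - 2 * (B - A)) - M).
    next_values y H 1%nat (B - (th - 2 * (B - A))).
    next_values y H 2%nat (B - A).
    next_values y H 3%nat (- A).
    next_values y H 4%nat ((B - A) + M - (th - 2 * (B - A))).
    next_values y H 5%nat (M - A).
    next_values y H 6%nat (M - B).
    next_values y H 7%nat M.
    next_values y H 8%nat (th - 2 * (B - A) - (B - A)).
    next_values y H 9%nat A.
    next_values y H 10%nat B.
    exists 11%nat, 0%nat; split; [lia|]; split; [right; split; [reflexivity|lra]|]; split.
    * simpl; solve_section.
    * intros HM; no_early_return.
Qed.

(** * Iterating the return map *)

Lemma state_shift (y : nat -> R) (s j : nat) :
  state (fun i => y (s + i)%nat) j = state y (s + j).
Proof. unfold state; now rewrite !Nat.add_assoc. Qed.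

Lemma recurrence_shift (y : nat -> R) (s : nat) :
  recurrence y -> recurrence (fun i => y (s + i)%nat).
Proof. intros H i; rewrite !Nat.add_assoc; apply H. Qed.

Lemma recurrence_of_solution (x : nat -> R) (n : nat) :
  solution x -> (1 <= n)%nat -> recurrence (fun i => x (n + i)%nat).
Proof. intros H Hn i; rewrite !Nat.add_assoc; apply H; lia. Qed.

Lemma state_determines (y : nat -> R) (j k : nat) :
  recurrence y -> state y j = state y k ->
  forall i, y (j + i)%nat = y (k + i)%nat.
Proof.
intros H Hs i.
enough (E : state y (j + i) = state y (k + i)) by now injection E.
induction i as [|i IH].
- now rewrite !Nat.add_0_r.
- unfold state in *; injection IH; intros E3 E2 E1 E0.
  assert (E4 : y (j + i + 4)%nat = y (k + i + 4)%nat) by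
    (rewrite !H; congruence).
  replace (j + S i + 1)%nat with (j + i + 2)%nat by lia.
  replace (j + S i + 2)%nat with (j + i + 3)%nat by lia.
  replace (j + S i + 3)%nat with (j + i + 4)%nat by lia.
  replace (k + S i + 1)%nat with (k + i + 2)%nat by lia.
  replace (k + S i + 2)%nat with (k + i + 3)%nat by lia.
  replace (k + S i + 3)%nat with (k + i + 4)%nat by lia.
  replace (j + S i)%nat with (j + i + 1)%nat by lia.
  replace (k + S i)%nat with (k + i + 1)%nat by lia.
  congruence.
Qed.

Lemma section_inj (M A B th th' : R) :
  A < B -> 0 <= th < M + 2 * (B - A) -> 0 <= th' < M + 2 * (B - A) ->
  section_point M A B th = section_point M A B th' -> th = th'.
Proof.
intros HAB H H'; unfold section_point.
repeat destruct Rle_dec; intros [=]; lra.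
Qed.

(* The [k]-th return to the section happens at time [11 * k - w], where [w]
   counts the returns that took 10 steps, i.e. those at which the phase [th]
   passes 0. *)
Definition visit (y : nat -> R) (M A B th0 : R) (k w : nat) (th : R) : Prop :=
  0 <= th < M + 2 * (B - A) /\
  th = th0 - INR k * (B - A) + INR w * (M + 2 * (B - A)) /\
  (w <= k)%nat /\
  state y (11 * k - w) = section_point M A B th.

Section Returns.

Variables (y : nat -> R) (M A B th0 : R).
Hypotheses (Hy : recurrence y) (HA : 0 <= A) (HAB : A < B) (HBM : B <= M).
Hypotheses (Hth0 : 0 <= th0 < M + 2 * (B - A))
  (Hst : state y 0 = section_point M A B th0).

Lemma visit_0 : visit y M A B th0 0 0 th0.
Proof. repeat split; simpl; try lra; assumption || lia. Qed.

Lemma visit_next (k w : nat) (th : R) :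
  visit y M A B th0 k w th ->
  exists r w' th', (0 < r)%nat /\ (w' <= S k)%nat /\
    (11 * S k - w' = 11 * k - w + r)%nat /\
    visit y M A B th0 (S k) w' th' /\
    (B - A < M -> forall j th'', (0 < j < r)%nat ->
       0 <= th'' < M + 2 * (B - A) ->
       state y (11 * k - w + j) <> section_point M A B th'').
Proof.
intros (Hth & Eth & Hw & E).
destruct (first_return (fun i => y (11 * k - w + i)%nat) M A B th)
  as (r & d & Hr & Hd & E' & Hearly); auto.
- now apply recurrence_shift.
- now rewrite state_shift, Nat.add_0_r.
- exists r, (w + d)%nat, (th - (B - A) + INR d * (M + 2 * (B - A))).
  split; [lia|]; split; [lia|]; split; [lia|]; split.
  + split; [|split; [|split; [lia|]]].
    * destruct Hd as [[-> ?]|[-> ?]]; simpl; lra.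
    * rewrite Eth, plus_INR, S_INR; ring.
    * rewrite state_shift in E'.
      now replace (11 * S k - (w + d))%nat with (11 * k - w + r)%nat by lia.
  + intros HM j th'' Hj Hth''; rewrite <- state_shift; auto.
Qed.

Lemma visit_exists (k : nat) : exists w th, visit y M A B th0 k w th.
Proof.
induction k as [|k (w & th & IH)].
- exists 0%nat, th0; apply visit_0.
- destruct (visit_next _ _ _ IH) as (_ & w' & th' & _ & _ & _ & H & _); eauto.
Qed.

(** Strong induction on the time left until [n]: [n] cannot lie strictly between two consecutive
    returns, so the next return is still at most [n]. *)
Lemma section_state_is_visit (n : nat) (th : R) :
  B - A < M -> 0 <= th < M + 2 * (B - A) -> state y n = section_point M A B th ->
  exists k w, n = (11 * k - w)%nat /\ visit y M A B th0 k w th.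
Proof.
intros HM Hth E.
enough (G : forall d k w th', visit y M A B th0 k w th' ->
          (11 * k - w + d = n)%nat ->
          exists k w, n = (11 * k - w)%nat /\ visit y M A B th0 k w th)
  by exact (G n 0%nat 0%nat th0 visit_0 eq_refl).
induction d as [d IH] using lt_wf_ind; intros k w th' V Hn.
destruct d as [|d].
- exists k, w; split; [lia|].
  replace th with th'; [assumption|].
  destruct V as (Hth' & _ & _ & E').
  apply (section_inj M A B); auto.
  now rewrite <- E, <- E', <- Hn, Nat.add_0_r.
- destruct (visit_next _ _ _ V) as (r & w' & th'' & Hr & Hw' & Er & V' & Hearly).
  destruct (Nat.lt_ge_cases (S d) r).
  + destruct (Hearly HM (S d) th); [lia | assumption | now rewrite Hn].
  + apply (IH (S d - r)%nat) with (2 := V'); lia.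
Qed.

(** After [q] returns the phase has changed by [w - a] full turns; both phases lie in the same
    half-open interval, so [w = a]. *)
Lemma rational_rotation_return (q a : nat) :
  INR q * (B - A) = INR a * (M + 2 * (B - A)) ->
  (a <= q)%nat /\ state y (11 * q - a) = state y 0.
Proof.
intros Hq.
destruct (visit_exists q) as (w & th & Hth & Eth & Hw & E).
assert (th = th0 + (INR w - INR a) * (M + 2 * (B - A))) as Eth' by lra.
assert (w = a) as ->.
{ destruct (Nat.lt_trichotomy w a) as [L|[L|L]]; [exfalso|assumption|exfalso];
    apply le_INR in L; rewrite S_INR in L; nra. }
split; [assumption|].
rewrite E, Hst; f_equal; lra.
Qed.

(** Time [m] is a visit with the initial phase, so its net rotation is zero. *)
Lemma return_time_rational (m : nat) :
  B - A < M -> state y m = state y 0 ->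
  exists q a, (a <= q)%nat /\ m = (11 * q - a)%nat /\
    INR q * (B - A) = INR a * (M + 2 * (B - A)).
Proof.
intros HM E; rewrite Hst in E.
destruct (section_state_is_visit m th0 HM Hth0 E) as (q & a & Em & _ & Eth & Ha & _).
exists q, a; repeat split; trivial; lra.
Qed.

End Returns.

(** * From a periodic solution to the section *)

(** The return gives the repetition only from [n] on; adding [n * m] carries any earlier index
    beyond [n]. *)
Lemma repeats_of_return (x : nat -> R) (m n r : nat) :
  solution x -> repeats_every x m -> (1 <= n)%nat -> (1 <= r)%nat ->
  state x (n + r) = state x n -> repeats_every x r.
Proof.
intros Hx [Hm Hper] Hn Hr E; split; [assumption|]; intros j Hj.
assert (Hmul : forall c i, (1 <= i)%nat -> x (i + c * m)%nat = x i).
{ induction c as [|c IH]; intros i Hi; [now rewrite Nat.add_0_r|].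
  replace (i + S c * m)%nat with (i + c * m + m)%nat by lia.
  rewrite Hper; [now apply IH|nia]. }
rewrite <- (Hmul n (j + r)%nat), <- (Hmul n j) by lia.
assert (H := state_determines _ r 0 (recurrence_of_solution x n Hx Hn)).
rewrite !state_shift, Nat.add_0_r in H.
specialize (H E (j + n * m - n)%nat).
replace (j + r + n * m)%nat with (n + (r + (j + n * m - n)))%nat by nia.
rewrite H; f_equal; nia.
Qed.

Lemma bounded_segment_max (x : nat -> R) (m : nat) :
  exists p, (1 <= p <= S m)%nat /\ forall i, (1 <= i <= S m)%nat -> x i <= x p.
Proof.
induction m as [|m (p & Hp & Hmax)].
- exists 1%nat; split; [lia|]; intros i Hi.
  replace i with 1%nat by lia; lra.
- destruct (Rle_dec (x p) (x (S (S m)))).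
  + exists (S (S m)); split; [lia|]; intros i Hi.
    destruct (Nat.eq_dec i (S (S m))) as [->|]; [lra|].
    apply Rle_trans with (x p); [apply Hmax; lia|assumption].
  + exists p; split; [lia|]; intros i Hi.
    destruct (Nat.eq_dec i (S (S m))) as [->|]; [lra|]; apply Hmax; lia.
Qed.

Lemma periodic_attains_max (x : nat -> R) (m : nat) :
  repeats_every x m ->
  exists n, (4 <= n)%nat /\ forall i, (1 <= i)%nat -> x i <= x n.
Proof.
intros [Hm Hper].
destruct (bounded_segment_max x m) as (p & Hp & Hmax).
(* Three extra periods make room for three terms before the maximum. *)
exists (p + m + m + m)%nat; split; [lia|].
rewrite !Hper by lia.
induction i as [i IH] using lt_wf_ind; intros Hi.
destruct (Nat.le_gt_cases i (S m)); [apply Hmax; lia|].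
replace i with (i - m + m)%nat by lia.
rewrite Hper by lia; apply IH; lia.
Qed.

(* Three steps before a maximum the recurrence reads
   [x (n + 1) = x n - x (n - 3)], and similarly for [x (n + 2)], [x (n + 3)];
   hence the three terms that follow a maximum are nonnegative. *)
Lemma nonneg_after_max (x : nat -> R) (n : nat) :
  solution x -> (4 <= n)%nat -> (forall i, (1 <= i)%nat -> x i <= x n) ->
  0 <= x (n + 1)%nat /\ 0 <= x (n + 2)%nat /\ 0 <= x (n + 3)%nat.
Proof.
intros Hx Hn Hmax.
destruct n as [|[|[|n]]]; [lia..|].
assert (H1 := Hx n ltac:(lia)); assert (H2 := Hx (S n) ltac:(lia));
  assert (H3 := Hx (S (S n)) ltac:(lia)).
assert (M1 := Hmax n ltac:(lia)); assert (M2 := Hmax (S n) ltac:(lia));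
  assert (M3 := Hmax (S (S n)) ltac:(lia)).
replace (n + 4)%nat with (S (S (S n)) + 1)%nat in H1 by lia.
replace (n + 3)%nat with (S (S (S n))) in H1 by lia.
replace (S n + 4)%nat with (S (S (S n)) + 2)%nat in H2 by lia.
replace (S n + 2)%nat with (S (S (S n))) in H2 by lia.
replace (S (S n) + 4)%nat with (S (S (S n)) + 3)%nat in H3 by lia.
replace (S (S n) + 1)%nat with (S (S (S n))) in H3 by lia.
rewrite H1, H2, H3; unfold Rmax; repeat destruct Rle_dec; lra.
Qed.

Lemma decreasing_state_returns (y : nat -> R) :
  recurrence y -> y 1%nat <= y 0%nat -> y 2%nat <= y 1%nat ->
  y 3%nat <= y 2%nat -> 0 <= y 3%nat -> state y 11 = state y 0.
Proof.
intros H H1 H2 H3 H4; unfold state; simpl.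
remember (y 0%nat) as M eqn:E0; remember (y 1%nat) as a eqn:E1;
  remember (y 2%nat) as b eqn:E2; remember (y 3%nat) as c eqn:E3.
symmetry in E0, E1, E2, E3.
next_values y H 0%nat (a - M).
next_values y H 1%nat (b - a).
next_values y H 2%nat (c - b).
next_values y H 3%nat (- c).
next_values y H 4%nat (M - a).
next_values y H 5%nat (M - b).
next_values y H 6%nat (M - c).
next_values y H 7%nat M.
next_values y H 8%nat a.
next_values y H 9%nat b.
next_values y H 10%nat c.
apply quadruple_eq; lra.
Qed.

(** Let [a], [b], [c] follow the maximum. If [a < b], then [A = a] and [B] is the larger of [b],
    [c]; if [b <= a] and [b < c], then [A = b] and [B = c]. The remaining triples are decreasing and
    return after 11 steps. *)
Lemma section_of_max (x : nat -> R) (n : nat) :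
  solution x -> (1 <= n)%nat ->
  x (n + 1)%nat <= x n -> x (n + 2)%nat <= x n -> x (n + 3)%nat <= x n ->
  0 <= x (n + 1)%nat -> 0 <= x (n + 2)%nat -> 0 <= x (n + 3)%nat ->
  state x (n + 11) = state x n \/
  exists s M A B th, (1 <= s)%nat /\ 0 <= A /\ A < B /\ B <= M /\
    0 <= th < M + 2 * (B - A) /\ state x s = section_point M A B th.
Proof.
intros Hx Hn L1 L2 L3 P1 P2 P3.
assert (H := recurrence_of_solution x n Hx Hn).
destruct (Rlt_dec (x (n + 1)%nat) (x (n + 2)%nat)).
- right; destruct (Rle_dec (x (n + 3)%nat) (x (n + 2)%nat)).
  + exists n, (x n), (x (n + 1)%nat), (x (n + 2)%nat), (x (n + 3)%nat).
    repeat split; try lia; try lra.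
    unfold state; solve_section.
  + exists n, (x n), (x (n + 1)%nat), (x (n + 3)%nat),
      (2 * x (n + 3)%nat - x (n + 2)%nat).
    repeat split; try lia; try lra.
    unfold state; solve_section.
- destruct (Rle_dec (x (n + 3)%nat) (x (n + 2)%nat)).
  + left.
    rewrite <- (Nat.add_0_r n) at 2; rewrite <- !state_shift.
    apply decreasing_state_returns; rewrite ?Nat.add_0_r; trivial; lra.
  + right; destruct (Rlt_dec (x (n + 1)%nat) (x n)).
    * exists n, (x n), (x (n + 2)%nat), (x (n + 3)%nat),
        (x (n + 1)%nat + 2 * (x (n + 3)%nat - x (n + 2)%nat)).
      repeat split; try lia; try lra.
      unfold state; solve_section.
    (* Two consecutive maxima: the phase would be the excluded endpoint [M + 2 * (B - A)], and one
       step later it is 0. *)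
    * exists (n + 1)%nat, (x n), (x (n + 2)%nat), (x (n + 3)%nat), 0.
      repeat split; try lia; try lra.
      assert (E4 : x (n + 4)%nat = 0).
      { rewrite Hx by lia; unfold Rmax; repeat destruct Rle_dec; lra. }
      unfold state; rewrite <- !Nat.add_assoc; simpl Nat.add; rewrite E4.
      solve_section.
Qed.

(** * Arithmetic of the periods *)

Lemma INR_eq_mul_cancel (g k w : nat) (b c : R) :
  (0 < g)%nat -> INR (g * k) * b = INR (g * w) * c -> INR k * b = INR w * c.
Proof.
intros Hg; rewrite !mult_INR; intros E.
apply lt_0_INR in Hg.
apply Rmult_eq_reg_l with (INR g); lra.
Qed.

Lemma period_form (m : nat) :
  Per_F4 m -> (32 < m)%nat ->
  exists q a, (0 < a)%nat /\ (3 * a < q)%nat /\ Nat.gcd q a = 1%nat /\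
    (m + a = 11 * q)%nat.
Proof.
intros (x & Hx & Hper & Hmin) Hm.
destruct (periodic_attains_max x m Hper) as (n & Hn & Hmax).
destruct (nonneg_after_max x n Hx Hn Hmax) as (P1 & P2 & P3).
destruct (section_of_max x n) as [E|(s & M & A & B & th & Hs & HA & HAB & HBM & Hth & E)];
  try apply Hmax; try lia; auto.
{ assert (m <= 11)%nat; [|lia].
  apply Hmin, (repeats_of_return x m n); auto; lia. }
assert (Hy := recurrence_of_solution x s Hx Hs).
assert (Hy0 : state (fun i => x (s + i)%nat) 0 = section_point M A B th)
  by now rewrite state_shift, Nat.add_0_r.
assert (Hret : forall q a, (1 <= 11 * q - a)%nat ->
    INR q * (B - A) = INR a * (M + 2 * (B - A)) -> (m <= 11 * q - a)%nat).
{ intros q a Hqa Eqa.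
  destruct (rational_rotation_return _ M A B th Hy HA HAB HBM Hth Hy0 q a Eqa)
    as [_ E'].
  rewrite !state_shift, Nat.add_0_r in E'.
  apply Hmin, (repeats_of_return x m s); auto. }
(* Equality [M = B - A] makes the circle three times the rotation: [q = 3], [a = 1] give a return
   after 32 steps. *)
destruct (Rle_lt_dec M (B - A)) as [HM|HM].
{ assert (m <= 32)%nat; [|lia].
  apply (Hret 3 1)%nat; [lia|simpl; lra]. }
assert (E' : state (fun i => x (s + i)%nat) m = state (fun i => x (s + i)%nat) 0).
{ destruct Hper as [_ Hper].
  rewrite !state_shift, Nat.add_0_r; unfold state.
  replace (s + m + 1)%nat with (s + 1 + m)%nat by lia.
  replace (s + m + 2)%nat with (s + 2 + m)%nat by lia.
  replace (s + m + 3)%nat with (s + 3 + m)%nat by lia.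
  now rewrite !Hper by lia. }
destruct (return_time_rational _ M A B th Hy HA HAB HBM Hth Hy0 m HM E')
  as (q & a & Haq & Em & Eqa).
assert (Ha : (0 < a)%nat).
{ destruct a as [|a]; [exfalso|lia].
  assert (Hq : 0 < INR q) by (apply lt_0_INR; lia).
  simpl in Eqa; nra. }
exists q, a; split; [assumption|]; split; [|split; [|lia]].
- apply INR_lt; rewrite mult_INR; simpl (INR 3).
  apply lt_0_INR in Ha; nra.
(* Cancelling the gcd [g] gives a return after [m / g] steps, so minimality of [m] forces
   [g = 1]. *)
- destruct (Nat.gcd_divide q a) as [[q' Eq'] [a' Ea']].
  remember (Nat.gcd q a) as g eqn:Eg.
  assert (Hg : (0 < g)%nat) by (destruct g; lia).
  assert (m <= 11 * q' - a')%nat; [|nia].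
  apply Hret; [nia|].
  apply INR_eq_mul_cancel with g; [assumption|].
  now rewrite <- !(Nat.mul_comm g), <- Eq', <- Ea' in *.
Qed.

(** * Realizing every coprime pair *)

Fixpoint orbit (s : R * R * R * R) (n : nat) : R * R * R * R :=
  match n with
  | 0%nat => s
  | S n =>
      let '(p, q, r, t) := orbit s n in (q, r, t, Rmax t (Rmax r (Rmax q 0)) - p)
  end.

Lemma solution_with_initial_state (s : R * R * R * R) :
  exists x, solution x /\ state x 1 = s.
Proof.
exists (fun n => fst (fst (fst (orbit s (n - 1))))).
split.
- intros n Hn; destruct n as [|n]; [lia|].
  replace (S n + 4 - 1)%nat with (S (S (S (S n)))) by lia.
  replace (S n + 3 - 1)%nat with (S (S (S n))) by lia.
  replace (S n + 2 - 1)%nat with (S (S n)) by lia.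
  replace (S n + 1 - 1)%nat with (S n) by lia.
  replace (S n - 1)%nat with n by lia.
  simpl; destruct (orbit s n) as [[[p q] r] t]; reflexivity.
- destruct s as [[[p q] r] t]; reflexivity.
Qed.

(** With [M = q - 2 * a], [A = 0], [B = a] the circle has length [q] and the rotation is by [a];
    [3 * a < q] is then [B - A < M]. *)
Lemma period_exists (q a : nat) :
  (0 < a)%nat -> (3 * a < q)%nat -> Nat.gcd q a = 1%nat -> Per_F4 (11 * q - a).
Proof.
intros Ha Haq Hgcd.
destruct (solution_with_initial_state (section_point (INR q - 2 * INR a) 0 (INR a) 0))
  as (x & Hx & E).
assert (Ha' := lt_0_INR a Ha).
assert (Haq' := lt_INR _ _ Haq); rewrite mult_INR in Haq'; simpl (INR 3) in Haq'.
assert (Hy := recurrence_of_solution x 1 Hx (le_n 1)).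
assert (Hy0 := E); rewrite <- (Nat.add_0_r 1), <- state_shift in Hy0.
set (M := INR q - 2 * INR a) in *.
assert (HM : INR a <= M) by (unfold M; lra).
assert (Hth : 0 <= 0 < M + 2 * (INR a - 0)) by (unfold M; lra).
exists x; split; [assumption|]; split.
- split; [lia|]; intros n Hn.
  destruct (rational_rotation_return _ M 0 (INR a) 0 Hy (Rle_refl 0) Ha' HM Hth Hy0 q a)
    as [_ E']; [unfold M; ring|].
  assert (H := state_determines _ _ _ Hy E' (n - 1)).
  cbv beta in H.
  replace (n + (11 * q - a))%nat with (1 + (11 * q - a + (n - 1)))%nat by lia.
  rewrite H; f_equal; lia.
- intros k [Hk Hper].
  assert (E' : state (fun i => x (1 + i)%nat) k = state (fun i => x (1 + i)%nat) 0).
  { rewrite !state_shift; unfold state.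
    replace (1 + k + 1)%nat with (2 + k)%nat by lia.
    replace (1 + k + 2)%nat with (3 + k)%nat by lia.
    replace (1 + k + 3)%nat with (4 + k)%nat by lia.
    now rewrite !Hper by lia. }
  destruct (return_time_rational _ M 0 (INR a) 0 Hy (Rle_refl 0) Ha' HM Hth Hy0 k)
    as (j & w & Hwj & -> & Ejw); [unfold M; lra|assumption|].
  assert (Ejw' : (j * a = w * q)%nat).
  { apply INR_eq; rewrite !mult_INR; unfold M in Ejw; lra. }
  (* Coprimality makes [j] a multiple [c * q], so the return time is [c * (11 * q - a)]. *)
  assert (D : Nat.divide q j).
  { apply Nat.gauss with a; [exists w; lia|assumption]. }
  destruct D as [c ->].
  assert (Hw : w = (c * a)%nat) by nia.
  subst w; destruct c as [|c]; [lia|nia].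
Qed.

Theorem mainTheorem2 :
  bounded_nat_set non_periods /\
  is_maximum non_periods 1674 /\
  ~ Per_F4 1674 /\
  (forall n : nat, (1674 < n)%nat -> Per_F4 n).
Proof.
assert (Hnot : ~ Per_F4 1674).
{ intros H; destruct (period_form 1674 H) as (q & a & Ha & Haq & G & E); [lia|].
  (* From [1674 < 11 * q] and [32 * q < 5022]; the gcds of these pairs are 9, 2, 31 and 6. *)
  assert (C : (q = 153 /\ a = 9 \/ q = 154 /\ a = 20 \/ q = 155 /\ a = 31 \/
    q = 156 /\ a = 42)%nat) by lia.
  destruct C as [[-> ->]|[[-> ->]|[[-> ->]|[-> ->]]]]; discriminate G. }
assert (Hper : forall n : nat, (1674 < n)%nat -> Per_F4 n).
{ intros n Hn; destruct (coprime_in_window n Hn) as (q & G & H1 & H2).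
  remember (11 * q - n)%nat as a eqn:Ea.
  assert (n = 11 * q - a)%nat as -> by lia.
  apply period_exists; [lia..|].
  apply Nat.divide_1_r; rewrite <- G; apply Nat.gcd_greatest;
    [apply Nat.gcd_divide_l|].
  apply Nat.divide_sub_r; [apply Nat.divide_mul_r, Nat.gcd_divide_l|].
  apply Nat.gcd_divide_r. }
assert (Hle : forall n : nat, non_periods n -> (n <= 1674)%nat).
{ intros n [_ Hn]; apply Nat.nlt_ge; auto. }
repeat split; trivial; [now exists 1674%nat|lia].
Qed.
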